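(* Suppose that $d_j \in [0,1)$ for $j=1, \ldots, n$ and that $P$ is an $n \times n$ partial stochastic matrix with $p_{j,j}=d_j$, $j=1, \ldots, n$, and all other entries unspecified. Then $$m(P)= \frac{1}{2 \sum_{j=1}^n \frac{1}{1-d_j} }\left( \left(\sum_{j=1}^n \frac{1}{1-d_j}\right)^2 - \sum_{j=1}^n \frac{1}{(1-d_j)^2} \right).$$
   Context: A stochastic matrix is a square, entrywise nonnegative real matrix each of whose row sums equals $1$. A partial matrix is one in which some entries are specified and the others are not; a completion is obtained by assigning values to all unspecified entries. A partial stochastic matrix is a partial matrix $P$ such that: (i) $P$ is square; (ii) all specified entries are nonnegative; (iii) in each row the sum of the specified entries is at most $1$, and it equals $1$ for any fully specified row; (iv) any row whose specified entries sum to $1$ is fully specified; (v) any row that is not fully specified contains at least two unspecified entries. $SC(P)$ denotes the set of all completions of $P$ that are stochastic matrices. The directed graph of an $n\times n$ stochastic matrix $T=[t_{i,j}]$ has vertices $1,\ldots,n$ and an arc $i\to j$ iff $t_{i,j}>0$. An index $j$ is essential if whenever there is a walk from $j$ to $k$ there is also a walk from $k$ to $j$. The essential indices are partitioned into essential classes: subsets within which any index can be reached from any other, and from which no index outside can be reached. $T$ has a single essential class if and only if $1$ is an algebraically simple eigenvalue of $T$. For a stochastic matrix $T$ of order $n$ with a single essential class and eigenvalues $1=\lambda_1,\lambda_2,\ldots,\lambda_n$ (with algebraic multiplicity), Kemeny's constant is $\mathcal{K}(T)=\sum_{j=2}^n \frac{1}{1-\lambda_j}$. If some stochastic completion of $P$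 has a single essential class, $m(P)=\inf\{\mathcal{K}(T) : T\in SC(P),\ T \text{ has a single essential class}\}$. *)

(* Defs.v *)
From HB Require Import structures.
From mathcomp Require Import all_boot all_order all_algebra.
From mathcomp Require Import complex.
From mathcomp Require Import classical_sets reals constructive_ereal ereal.

Set Implicit Arguments.
Unset Strict Implicit.
Unset Printing Implicit Defensive.

Import Order.TTheory GRing.Theory Num.Theory.

Local Open Scope ring_scope.
Local Open Scope complex_scope.

Definition stochastic (R : realType) (n : nat) (T : 'M[R]_n) : Prop :=
  (forall i j, 0 <= T i j) /\ (forall i, \sum_j T i j = 1).

(* In a partial matrix, [Some x] is an entry specified to be x and [None] an
   unspecified one. *)
Definition fully_specified (R : realType) (n : nat) (P : 'M[option R]_n)
    (i : 'I_n) : bool :=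
  [forall j, isSome (P i j)].

Definition specified_sum (R : realType) (n : nat) (P : 'M[option R]_n)
    (i : 'I_n) : R :=
  \sum_(j | isSome (P i j)) odflt 0 (P i j).

Record partial_stochastic (R : realType) (n : nat) (P : 'M[option R]_n) :
    Prop := PartialStochastic {
  specified_ge0 : forall i j x, P i j = Some x -> 0 <= x;
  specified_sum_le1 : forall i, specified_sum P i <= 1;
  fully_specified_sum1 : forall i, fully_specified P i -> specified_sum P i = 1;
  sum1_fully_specified : forall i, specified_sum P i = 1 -> fully_specified P i;
  two_unspecified : forall i, ~~ fully_specified P i ->
    (2 <= #|[set j | ~~ isSome (P i j)]|)%N
}.

Definition completion (R : realType) (n : nat) (P : 'M[option R]_n)
    (T : 'M[R]_n) : Prop :=
  forall i j x, P i j = Some x -> T i j = x.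

Definition SC (R : realType) (n : nat) (P : 'M[option R]_n) : set 'M[R]_n :=
  [set T | completion P T /\ stochastic T]%classic.

Definition arc (R : realType) (n : nat) (T : 'M[R]_n) : rel 'I_n :=
  fun i j => 0 < T i j.

Definition essential (R : realType) (n : nat) (T : 'M[R]_n) (j : 'I_n) : bool :=
  [forall k, connect (arc T) j k ==> connect (arc T) k j].

Definition essential_classes (R : realType) (n : nat) (T : 'M[R]_n) :
    {set {set 'I_n}} :=
  equivalence_partition
    (fun i j => connect (arc T) i j && connect (arc T) j i)
    [set j | essential T j].

Definition single_essential_class (R : realType) (n : nat) (T : 'M[R]_n) :
    Prop :=
  #|essential_classes T| = 1%N.

(* The complex eigenvalues, repeated according to algebraic multiplicity: the
   roots of the characteristic polynomial of T over R[i]. *)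
Definition eigenvalues (R : realType) (n : nat) (T : 'M[R]_n) : seq R[i] :=
  sval (closed_field_poly_normal (char_poly (map_mx (real_complex R) T))).

Lemma eigenvaluesP (R : realType) (n : nat) (T : 'M[R]_n) :
  char_poly (map_mx (real_complex R) T)
  = \prod_(z <- eigenvalues T) ('X - z%:P).
Proof.
rewrite /eigenvalues; case: closed_field_poly_normal => s /= {1}->.
by rewrite (monicP (char_poly_monic _)) scale1r.
Qed.

(* [rem 1] discards one occurrence of the eigenvalue 1.  The sum is a complex
   number with zero imaginary part (lemma [kemenyE]). *)
Definition kemeny (R : realType) (n : nat) (T : 'M[R]_n) : R :=
  complex.Re (\sum_(z <- rem 1 (eigenvalues T)) 1 / (1 - z)).

Lemma kemenyE (R : realType) (n : nat) (T : 'M[R]_n) :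
  (kemeny T)%:C = \sum_(z <- rem 1 (eigenvalues T)) 1 / (1 - z).
Proof.
rewrite /kemeny.
have -> : \sum_(z <- rem 1 (eigenvalues T)) 1 / (1 - z)
          = \sum_(z <- eigenvalues T) 1 / (1 - z).
  have [h|/rem_id -> //] := boolP (1 \in eigenvalues T).
  by rewrite [RHS](big_rem _ h) /= subrr invr0 mulr0 add0r.
set S := \sum_(z <- _) _.
have hp : perm_eq (map (@conjc R) (eigenvalues T)) (eigenvalues T).
  apply: prod_XsubC_eq; rewrite -eigenvaluesP.
  have -> : map_mx (real_complex R) T
            = map_mx (@conjc R) (map_mx (real_complex R) T).
    by apply/matrixP => i j; rewrite !mxE /= oppr0.
  rewrite -map_char_poly eigenvaluesP rmorph_prod /= big_map.
  by apply: eq_bigr => z _; rewrite rmorphB /= map_polyX map_polyC.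
have hc : conjc S = S.
  rewrite /S rmorph_sum -[RHS](perm_big _ hp) big_map /=.
  by apply: eq_bigr => z _; rewrite !mul1r fmorphV rmorphB rmorph1.
move: hc; case: (S) => a b [] /eqP; rewrite eq_sym -addr_eq0 -mulr2n.
by rewrite mulrn_eq0 /= => /eqP ->.
Qed.

(* The infimum is taken in the extended reals, so that no junk value is
   involved: it is +oo when no stochastic completion of P has a single essential
   class, and -oo when the set is unbounded below. *)
Definition m (R : realType) (n : nat) (P : 'M[option R]_n) : \bar R :=
  ereal_inf
    [set (kemeny T)%:E | T in [set T | SC P T /\ single_essential_class T]]%classic.

(* Main.v *)
Require Import Defs.
From mathcomp Require Import all_boot all_order all_algebra.
From mathcomp Require Import complex polyrcf ring lra.
From mathcomp Require Import classical_sets reals constructive_ereal ereal.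

(** Write [L = 1 - T].  For a set [I] of indices, let [tau_I] be the principal
    minor of [L] obtained by deleting the rows and columns in [I]; by the
    matrix-tree theorem it is the weight of the spanning forests rooted at [I].
    Since [1] is an eigenvalue of [T], the sum of [1 / (1 - lambda)] over the
    other eigenvalues is a logarithmic derivative of the characteristic
    polynomial [chi] with one factor ['X - 1] removed, so
    [K(T) = chi''(1) / (2 chi'(1))].  Differentiating [chi] row by row turns
    this into (lemma [kemeny_minors])
      [K(T) = (sum over i <> j of tau_ij) / (2 * sum over i of tau_i)].
    The denominator is positive when there is a single essential class, because
    then [tau_i > 0] for any [i] that is reachable from everywhere.

    The matrix [L] is a (weakly) diagonally dominant M-matrix.  For such a
    matrix a determinant is at most a diagonal entry times the complementary
    minor (lemma [dominant_det_le]); hence [tau_i <= (1 - d_j) tau_ij].  With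
    [a_j = 1 / (1 - d_j)] this says that [tau_ij] is at least the larger of
    [a_j tau_i] and [a_i tau_j], and the theorem is reduced to an inequality on
    the numbers [a_i > 0] and [tau_i >= 0].  Let [S] be the sum of the [a_i].
    The maximum of two numbers [u] and [v] is half of [u + v + |u - v|], and
    [|a_i - a_j| <= S], so
      [2 S tau_ij >= S (u + v) + (a_i - a_j) (u - v)]
    for [u = a_j tau_i] and [v = a_i tau_j].  Summed over [i <> j], the right
    side is exactly [2 (S^2 - sum of the a_i^2) * (sum of the tau_i)], which
    gives the lower bound.

    The bound is attained.  All the inequalities are equalities as soon as
    [tau_i = (1 - d_j) tau_ij] for all [i <> j], and this holds when the only
    transitions of the chain, besides staying in place, go along one directed
    cycle through all the indices. *)

Set Implicit Arguments.
Unset Strict Implicit.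
Unset Printing Implicit Defensive.

Import Order.TTheory GRing.Theory Num.Theory.

Local Open Scope ring_scope.

Local Notation arc := Defs.arc.

(** * Principal minors and cofactors *)

Section Pin.

(** Expanding [pin i A] along row [i] shows that its determinant is the minor of
    [A] without row and column [i].  Pinning keeps the size of the matrix, so
    that minors without several indices need no reindexing. *)
Definition pin (K : nzRingType) (n : nat) (i : 'I_n) (A : 'M[K]_n) : 'M[K]_n :=
  \matrix_(k, l) if k == i then (k == l)%:R else A k l.

Lemma pinC (K : nzRingType) n (i j : 'I_n) (A : 'M[K]_n) :
  pin i (pin j A) = pin j (pin i A).
Proof. by apply/matrixP=> k l; rewrite !mxE; do 2!case: ifP. Qed.

Lemma map_pin (K K' : nzRingType) (f : {rmorphism K -> K'}) n (i : 'I_n)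
    (A : 'M[K]_n) : map_mx f (pin i A) = pin i (map_mx f A).
Proof.
by apply/matrixP=> k l; rewrite !mxE; case: ifP => // _; rewrite rmorph_nat.
Qed.

Lemma cofactor_pin (K : comNzRingType) n (j k : 'I_n) (A : 'M[K]_n) :
  cofactor (pin j A) j k = cofactor A j k.
Proof.
rewrite /cofactor; congr (_ * \det _).
by apply/matrixP=> x y; rewrite !mxE eq_sym (negPf (neq_lift _ _)).
Qed.

Lemma cofactor_diag (K : comNzRingType) n (j : 'I_n) (A : 'M[K]_n) :
  cofactor A j j = \det (pin j A).
Proof.
rewrite (expand_det_row _ j) (bigD1 j) //= mxE !eqxx mul1r cofactor_pin.
rewrite big1 ?addr0 // => k kj.
by rewrite mxE eqxx eq_sym (negPf kj) mul0r.
Qed.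

(** The product [A *m \adj A] read entrywise: the cofactors of row [j] form a
    vector that every other row of [A] annihilates.  This is the form in which
    cofactors are compared below, by treating them as a harmonic function. *)
Lemma mul_cofactor (K : comNzRingType) n (i j : 'I_n) (A : 'M[K]_n) :
  \sum_k A i k * cofactor A j k = (\det A) *+ (i == j).
Proof.
have /matrixP/(_ i j) := mul_mx_adj A.
by rewrite !mxE => <-; apply: eq_bigr => k _; rewrite mxE.
Qed.

End Pin.

(** * Diagonally dominant M-matrices *)

Section Dominance.
Variables (R : rcfType) (n : nat).
Implicit Types (A : 'M[R]_n).

(** For nonpositive off-diagonal entries, diagonal dominance by rows amounts to
    nonnegative row sums. *)
Definition dominant A :=
  (forall i j, i != j -> A i j <= 0) /\ (forall i, 0 <= \sum_j A i j).
Definition strictly_dominant A :=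
  (forall i j, i != j -> A i j <= 0) /\ (forall i, 0 < \sum_j A i j).

Lemma sum_pin A i k :
  \sum_l pin i A k l = if k == i then 1 else \sum_l A k l.
Proof.
case: ifP => ki; last by apply: eq_bigr => l _; rewrite mxE ki.
rewrite (bigD1 k) //= mxE ki eqxx big1 ?addr0 // => l lk.
by rewrite mxE ki eq_sym (negPf lk).
Qed.

Lemma pin_offdiag A i : (forall k l, k != l -> A k l <= 0) ->
  forall k l, k != l -> pin i A k l <= 0.
Proof.
by move=> A0 k l kl; rewrite mxE; case: ifP => _; [rewrite (negPf kl)|exact: A0].
Qed.

Lemma dominant_pin A i : dominant A -> dominant (pin i A).
Proof.
move=> [A0 As]; split; first exact: pin_offdiag.
by move=> k; rewrite sum_pin; case: ifP.
Qed.

Lemma strictly_dominant_pin A i :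
  strictly_dominant A -> strictly_dominant (pin i A).
Proof.
move=> [A0 As]; split; first exact: pin_offdiag.
by move=> k; rewrite sum_pin; case: ifP.
Qed.

Lemma dominant_perturb A t : 0 < t -> dominant A ->
  strictly_dominant (t%:M + A).
Proof.
move=> t0 [A0 As]; split.
  by move=> i j ij; rewrite !mxE (negPf ij) add0r A0.
move=> i; under eq_bigr do rewrite !mxE.
rewrite big_split /= ltr_wpDr //.
rewrite (bigD1 i) //= eqxx big1 ?addr0 // => l li.
by rewrite eq_sym (negPf li).
Qed.

(** Replacing each [y l], [l != k], by its lower bound [b] can only increase the
    sum, because the off-diagonal weights are nonpositive. *)
Lemma row_sum_bound A k (y : 'I_n -> R) (b : R) :
  (forall i j, i != j -> A i j <= 0) -> (forall l, b <= y l) ->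
  \sum_l A k l * y l <= A k k * (y k - b) + b * \sum_l A k l.
Proof.
move=> A0 by_; rewrite mulr_sumr [X in X <= _](bigD1 k) //=.
rewrite [X in _ <= _ + X](bigD1 k) //= addrA lerD //.
  by rewrite mulrBr [b * _]mulrC subrK.
apply: ler_sum => l lk; rewrite mulrC ler_wnM2r //.
by apply: A0; rewrite eq_sym.
Qed.

(** Minimum principle: at an index [k != j] where [y] takes a negative minimum,
    [row_sum_bound] makes the [k]-th entry of [A y] negative. *)
Lemma harmonic_ge0 A j (y : 'I_n -> R) :
  strictly_dominant A -> 0 <= y j ->
  (forall k, k != j -> 0 <= \sum_l A k l * y l) -> forall k, 0 <= y k.
Proof.
move=> [A0 As] yj hy k0.
pose k := [arg min_(i < k0) y i]%O.
have ky l : y k <= y l by rewrite /k; case: arg_minP => // i _; apply.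
apply: le_trans (ky k0); rewrite leNgt; apply/negP => yk.
have kj : k != j by apply: contraTneq yk => ->; rewrite -leNgt.
have := hy k kj; apply/negP; rewrite -ltNge.
apply: le_lt_trans (row_sum_bound k A0 ky) _.
by rewrite subrr mulr0 add0r nmulr_rlt0.
Qed.

(** The minimum principle applies to the cofactors of row [j], which the other
    rows annihilate, and to their differences from the diagonal cofactor, on
    which the other rows are nonnegative. *)
Lemma cofactor_bounds A j : strictly_dominant A -> 0 <= \det (pin j A) ->
  forall k, 0 <= cofactor A j k <= \det (pin j A).
Proof.
move=> sA p0 k; apply/andP; split.
  apply: (harmonic_ge0 sA (j := j)); first by rewrite cofactor_diag.
  by move=> i ij; rewrite mul_cofactor (negPf ij).
rewrite -subr_ge0; pose y l := \det (pin j A) - cofactor A j l.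
rewrite -[X in 0 <= X]/(y k).
apply: (harmonic_ge0 sA (j := j)); first by rewrite /y cofactor_diag subrr.
move=> i ij; under eq_bigr do rewrite mulrBr.
rewrite sumrB mul_cofactor (negPf ij) subr0 -mulr_suml mulr_ge0 //.
exact/ltW/(proj2 sA).
Qed.

(** Induction on the number of rows that differ from those of the identity:
    expand along such a row [j].  The cofactors are at most the diagonal one,
    so the determinant is at least the row sum times the minor [pin j A], which
    has one more row of the identity. *)
Lemma strictly_dominant_det_ge0 A : strictly_dominant A -> 0 <= \det A.
Proof.
have [m] := ubnP #|[set i | row i A != row i 1%:M]|.
elim: m A => // m IH A; rewrite ltnS => cA sA.
have [s0|[j]] := set_0Vmem [set i | row i A != row i 1%:M].
  suff -> : A = 1%:M by rewrite det1.
  apply/row_matrixP => i; apply/eqP; apply: contraT => iA.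
  by rewrite -(finset.in_set0 i) -s0 inE.
rewrite inE => jA.
have p0 : 0 <= \det (pin j A).
  apply: IH; last exact: strictly_dominant_pin.
  apply: leq_trans cA; apply/proper_card/properP; split; last first.
    exists j; rewrite !inE // negbK; apply/eqP/rowP => l.
    by rewrite !mxE eqxx.
  apply/fintype.subsetP => i; rewrite !inE; apply: contraNN => /eqP iA.
  apply/eqP/rowP => l; move/rowP/(_ l): iA; rewrite !mxE.
  by case: ifP => //.
have cb := cofactor_bounds sA p0.
have := mul_cofactor j j A; rewrite eqxx mulr1n => <-.
have jb l : \det (pin j A) >= cofactor A j l by have /andP[] := cb l.
apply: le_trans (_ : \det (pin j A) * \sum_l A j l <= _).
  by rewrite mulr_ge0 //; apply/ltW/(proj2 sA).
rewrite mulr_sumr; apply: ler_sum => l _.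
have [<-|jl] := eqVneq j l; first by rewrite cofactor_diag mulrC.
by rewrite mulrC ler_wnM2l // (proj1 sA).
Qed.

(** In the expansion along row [j] the off-diagonal terms are nonpositive. *)
Lemma strictly_dominant_det_le A j : strictly_dominant A ->
  \det A <= A j j * \det (pin j A).
Proof.
move=> sA.
have p0 : 0 <= \det (pin j A).
  exact/strictly_dominant_det_ge0/strictly_dominant_pin.
have := mul_cofactor j j A; rewrite eqxx mulr1n => <-.
rewrite (bigD1 j) //= -cofactor_diag gerDl sumr_le0 // => l lj.
have /andP[c0 _] := cofactor_bounds sA p0 l.
by rewrite mulr_le0_ge0 // (proj1 sA) // eq_sym.
Qed.

Lemma horner0_ge0 (p : {poly R}) : (forall t, 0 < t -> 0 <= p.[t]) -> 0 <= p.[0].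
Proof.
move=> h; rewrite leNgt; apply/negP => p0.
have [|d d0 hd] := @poly_cont R 0 p (- p.[0]); first by rewrite oppr_gt0.
have d2 : 0 < d / 2 by rewrite divr_gt0.
have /hd/ltr_normlW : `|d / 2 - 0| < d by rewrite subr0 gtr0_norm //; lra.
by rewrite ltrBlDr addNr ltNge h.
Qed.

(** The perturbation [t%:M + A] is strictly dominant for [t > 0]; this presents
    it as the value of a polynomial matrix, so that strict statements pass to
    the limit [t = 0] through [horner0_ge0]. *)
Lemma horner_char_poly_mxN A t :
  map_mx (horner_eval t) (char_poly_mx (- A)) = t%:M + A.
Proof.
apply/matrixP => i j; rewrite !mxE horner_evalE.
by case: (i == j); rewrite ?mulr1n ?mulr0n !hornerE opprK.
Qed.

Lemma dominant_det_ge0 A : dominant A -> 0 <= \det A.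
Proof.
move=> dA.
have hp t : (char_poly (- A)).[t] = \det (t%:M + A).
  by rewrite -horner_char_poly_mxN det_map_mx.
have -> : \det A = (char_poly (- A)).[0].
  by rewrite hp raddf0 add0r.
apply: horner0_ge0 => t t0; rewrite hp.
exact/strictly_dominant_det_ge0/dominant_perturb.
Qed.

(** A Hadamard-Fischer inequality.  In terms of forests: dropping the arc that
    leaves [j] makes [j] a further root, and the arcs that can be dropped have
    total weight at most [A j j]. *)
Lemma dominant_det_le A j : dominant A -> \det A <= A j j * \det (pin j A).
Proof.
move=> dA; pose p :=
  ('X + (A j j)%:P) * \det (pin j (char_poly_mx (- A))) - char_poly (- A).
have hp t : p.[t] = (t%:M + A) j j * \det (pin j (t%:M + A)) - \det (t%:M + A).
  rewrite -horner_char_poly_mxN -map_pin !det_map_mx !hornerE.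
  by rewrite horner_char_poly_mxN !mxE eqxx mulr1n.
have := @horner0_ge0 p; rewrite hp !mxE mul0rn add0r raddf0 add0r subr_ge0.
apply=> t t0; rewrite hp subr_ge0.
exact/strictly_dominant_det_le/dominant_perturb.
Qed.

End Dominance.

(** * Kemeny's constant as a quotient of sums of minors *)

Section Deriv.
Variable K : comNzRingType.

Lemma deriv_prod_uniq (I : eqType) (r : seq I) (F : I -> {poly K}) : uniq r ->
  (\prod_(i <- r) F i)^`() =
  \sum_(i <- r) \prod_(j <- r) (if j == i then (F j)^`() else F j).
Proof.
elim: r => [|a r IH] /=; first by rewrite !big_nil derivC.
move=> /andP[ar ur]; rewrite !big_cons derivM IH // eqxx; congr (_ * _ + _).
  by apply: eq_big_seq => j jr; case: eqP => // ja; rewrite -ja jr in ar.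
rewrite mulr_sumr; apply: eq_big_seq => i ir; rewrite big_cons.
by case: eqP => // ai; rewrite ai ir in ar.
Qed.

Lemma deriv_det n (A : 'M[{poly K}]_n) :
  (\det A)^`() =
  \sum_i \det (\matrix_(k, l) if k == i then (A k l)^`() else A k l).
Proof.
rewrite /determinant raddf_sum exchange_big /=; apply: eq_bigr => s _.
rewrite -mulr_sumr.
rewrite -(rmorph_sign polyC).
rewrite mul_polyC derivZ -mul_polyC deriv_prod_uniq ?index_enum_uniq //.
congr (_ * _); apply: eq_bigr => i _; apply: eq_bigr => j _.
by rewrite mxE.
Qed.

(** The derivative of row [i] of [char_poly_mx T] is the [i]-th unit row, which
    is what [pin] puts there. *)
Lemma deriv_char_poly n (T : 'M[K]_n) :
  (char_poly T)^`() = \sum_i \det (pin i (char_poly_mx T)).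
Proof.
rewrite deriv_det; apply: eq_bigr => i _; congr (\det _).
apply/matrixP => k l; rewrite !mxE; case: ifP => // _.
by rewrite derivB derivC subr0 derivMn derivX.
Qed.

(** The derivative of an already pinned row vanishes, so only the pairs with
    [j != i] contribute. *)
Lemma deriv2_char_poly n (T : 'M[K]_n) :
  (char_poly T)^`()^`() =
  \sum_i \sum_(j | j != i) \det (pin j (pin i (char_poly_mx T))).
Proof.
rewrite deriv_char_poly raddf_sum /=; apply: eq_bigr => i _.
rewrite deriv_det (bigD1 i) //= [X in X + _](_ : _ = 0) ?add0r.
  apply: eq_bigr => j ji; congr (\det _).
  apply/matrixP => k l; rewrite !mxE; case: ifP => // /eqP ->.
  by rewrite (negPf ji) derivB derivC subr0 derivMn derivX.
rewrite (expand_det_row _ i) big1 // => k _.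
by rewrite !mxE eqxx -polyC_natr derivC mul0r.
Qed.

Lemma horner1_char_poly_mx n (T : 'M[K]_n) :
  map_mx (horner_eval 1) (char_poly_mx T) = 1%:M - T.
Proof.
apply/matrixP => i j; rewrite !mxE horner_evalE.
by case: (i == j); rewrite ?mulr1n ?mulr0n !hornerE.
Qed.

End Deriv.

(** The logarithmic derivative of a product of linear factors. *)
Lemma sum_inv_root (F : fieldType) (r : seq F) (x : F) :
  let p := \prod_(z <- r) ('X - z%:P) in
  p.[x] != 0 -> \sum_(z <- r) 1 / (x - z) = p^`().[x] / p.[x].
Proof.
elim: r => [|a r IH] /=; first by rewrite !big_nil derivC horner0 mul0r.
rewrite !big_cons hornerM mulf_eq0 negb_or => /andP[ha hr].
rewrite IH // derivM hornerD !hornerM derivXsubC hornerC.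
move: ha hr; rewrite !hornerE => ha hr.
by field; rewrite hr ha.
Qed.

Section Kemeny.
Variables (R : realType) (n : nat).
Implicit Types T : 'M[R]_n.

Lemma char_poly1 T : (0 < n)%N -> (forall i, \sum_j T i j = 1) ->
  (char_poly T).[1] = 0.
Proof.
case: n T => // n' T _ hT.
have -> : (char_poly T).[1] = \det (1%:M - T).
  by rewrite -horner1_char_poly_mx det_map_mx.
rewrite -det_tr; apply/eqP/det0P; exists (const_mx 1).
  by apply/eqP => /rowP/(_ 0)/eqP; rewrite !mxE oner_eq0.
apply/rowP => i; rewrite !mxE.
under eq_bigr do rewrite !mxE mul1r.
rewrite sumrB hT (bigD1 i) //= eqxx big1 ?addr0 ?subrr // => l li.
by rewrite eq_sym (negPf li).
Qed.

(** If [chi = ('X - 1) p] then [chi'(1) = p(1)] and [chi''(1) = 2 p'(1)], while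
    Kemeny's constant is [p'(1) / p(1)]. *)
Lemma kemeny_deriv T : (0 < n)%N -> (forall i, \sum_j T i j = 1) ->
  (char_poly T)^`().[1] != 0 ->
  kemeny T = (char_poly T)^`()^`().[1] / (2 * (char_poly T)^`().[1]).
Proof.
move=> n0 hT h1; pose f : {rmorphism R -> R[i]} := real_complex R.
have fE : map_poly f (char_poly T) = \prod_(z <- eigenvalues T) ('X - z%:P).
  by rewrite -eigenvaluesP map_char_poly.
have e1 : 1 \in eigenvalues T.
  rewrite -root_prod_XsubC -fE -[1](rmorph1 f) /root horner_map /=.
  by rewrite (char_poly1 n0 hT) rmorph0.
(* [p] is the characteristic polynomial with one factor ['X - 1] removed. *)
pose p : {poly R[i]} := \prod_(z <- rem 1 (eigenvalues T)) ('X - z%:P).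
have fp : map_poly f (char_poly T) = ('X - 1%:P) * p.
  by rewrite fE (big_rem _ e1).
have p1 : p.[1] = f (char_poly T)^`().[1].
  rewrite -horner_map rmorph1 -deriv_map /= fp derivM derivXsubC.
  by rewrite !hornerE ?subrr ?mul0r ?addr0.
have p2 : 2 * p^`().[1] = f (char_poly T)^`()^`().[1].
  rewrite -horner_map rmorph1 -!deriv_map /= fp derivM derivXsubC mul1r.
  rewrite derivD derivM derivXsubC mul1r !hornerD hornerM hornerXsubC.
  by rewrite subrr mul0r addr0 mulr_natl mulr2n.
have p10 : p.[1] != 0 by rewrite p1 fmorph_eq0.
apply: (fmorph_inj f).
rewrite [LHS]kemenyE sum_inv_root // -/p.
rewrite fmorph_div rmorphM rmorph_nat -p1 -p2.
by rewrite -mulf_div divff ?mul1r // pnatr_eq0.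
Qed.

Lemma kemeny_minors T : (0 < n)%N -> (forall i, \sum_j T i j = 1) ->
  \sum_i \det (pin i (1%:M - T)) != 0 ->
  kemeny T = (\sum_i \sum_(j | j != i) \det (pin j (pin i (1%:M - T))))
             / (2 * \sum_i \det (pin i (1%:M - T))).
Proof.
move=> n0 hT.
have h1 : (char_poly T)^`().[1] = \sum_i \det (pin i (1%:M - T)).
  rewrite deriv_char_poly horner_sum; apply: eq_bigr => i _.
  by rewrite -horner1_char_poly_mx -map_pin det_map_mx.
have h2 : (char_poly T)^`()^`().[1] =
    \sum_i \sum_(j | j != i) \det (pin j (pin i (1%:M - T))).
  rewrite deriv2_char_poly horner_sum; apply: eq_bigr => i _.
  rewrite horner_sum; apply: eq_bigr => j _.
  by rewrite -horner1_char_poly_mx -!map_pin det_map_mx.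
by rewrite -h1 -h2; apply: kemeny_deriv.
Qed.

End Kemeny.

(** * Minors of a chain with a single essential class *)

Section Chains.
Variables (R : realType) (n : nat).
Implicit Types T : 'M[R]_n.

Lemma sum_row_sub1 T i (y : 'I_n -> R) :
  \sum_j (1%:M - T) i j * y j = y i - \sum_j T i j * y j.
Proof.
under eq_bigr do rewrite !mxE mulrBl.
rewrite sumrB (bigD1 i) //= eqxx mul1r big1 ?addr0 // => l li.
by rewrite eq_sym (negPf li) mul0r.
Qed.

Lemma stochastic_dominant T : stochastic T -> dominant (1%:M - T).
Proof.
move=> [T0 T1]; split.
  by move=> i j ij; rewrite !mxE (negPf ij) add0r oppr_le0.
move=> i; have := sum_row_sub1 T i (fun=> 1).
under eq_bigr do rewrite mulr1.
by under [X in _ = _ - X]eq_bigr do rewrite mulr1; rewrite T1 subrr => ->.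
Qed.

(** Among the indices reachable from [k], one that reaches the fewest indices
    is essential: whatever it reaches reaches as many, hence the same, indices. *)
Lemma essential_reachable T k : exists2 l, connect (arc T) k l & essential T l.
Proof.
pose N i := #|[pred j | connect (arc T) i j]|.
case: (arg_minnP N (connect0 (arc T) k)) => l kl lmin.
exists l => //; apply/forallP => j; apply/implyP => lj.
have /lmin Nlj : connect (arc T) k j by exact: connect_trans kl lj.
have sub : [pred x | connect (arc T) j x] \subset [pred x | connect (arc T) l x].
  by apply/fintype.subsetP => x; apply: connect_trans.
have /subset_cardP/(_ sub)/(_ l) :
    #|[pred x | connect (arc T) j x]| = #|[pred x | connect (arc T) l x]|.
  by apply/eqP; rewrite eqn_leq subset_leq_card.
by rewrite !inE connect0.
Qed.

Lemma single_essential_class_reachable T : single_essential_class T ->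
  exists i, forall k, connect (arc T) k i.
Proof.
move=> /eqP/cards1P[C hC].
have cls x : essential T x -> C =
    [set y in [set j | essential T j] |
       connect (arc T) x y && connect (arc T) y x].
  move=> ex; apply/esym/set1P; rewrite -hC; apply/imsetP.
  by exists x => //; rewrite inE.
have [i iC] : exists i, essential T i.
  have /imsetP[x] : C \in essential_classes T by rewrite hC set11.
  by rewrite inE => ex _; exists x.
exists i => k; have [l kl el] := essential_reachable T k.
apply: (connect_trans kl).
have : i \in C by rewrite (cls _ iC) !inE iC connect0.
by rewrite (cls _ el) inE => /and3P[_ ->].
Qed.

(** Maximum principle for a harmonic function that vanishes at [i]: from an
    index where the maximum is attained, a positive maximum would propagate
    along the arcs all the way to [i]. *)
Lemma harmonic_le0 T i (x : 'I_n -> R) : stochastic T ->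
  (forall k, connect (arc T) k i) -> x i = 0 ->
  (forall k, k != i -> x k = \sum_l T k l * x l) -> forall k, x k <= 0.
Proof.
move=> [T0 T1] Ti xi hx k0.
pose b := x [arg max_(k > i) x k]%O.
have xb l : x l <= b by rewrite /b; case: arg_maxP => // j _; apply.
apply: le_trans (xb k0) _; rewrite leNgt; apply/negP => b0.
have step k l : x k = b -> arc T k l -> x l = b.
  move=> xk Tkl; have ki : k != i.
    by apply/eqP => ki; move: b0; rewrite -xk ki xi ltxx.
  have : \sum_l T k l * (b - x l) = 0.
    under eq_bigr do rewrite mulrBr.
    by rewrite sumrB -mulr_suml T1 mul1r -hx // xk subrr.
  have Tx0 j : true -> 0 <= T k j * (b - x j) by rewrite mulr_ge0 ?subr_ge0.
  move=> /(psumr_eq0P Tx0)/(_ l isT)/eqP.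
  by rewrite mulf_eq0 gt_eqF //= subr_eq0 => /eqP.
have : x i = b; last by move=> xib; move: b0; rewrite -xib xi ltxx.
have /connectP[p pth ->] := Ti [arg max_(k > i) x k]%O.
elim: p [arg max_(k > i) x k]%O pth (erefl b : x _ = b) => //= l p IH k.
by move=> /andP[kl /IH h] /step/(_ kl).
Qed.

(** A vector in the kernel of the pinned matrix vanishes at [i] and is harmonic
    elsewhere, so the maximum principle, applied to it and to its opposite,
    makes it zero. *)
Lemma minor_neq0 T i : stochastic T -> (forall k, connect (arc T) k i) ->
  \det (pin i (1%:M - T)) != 0.
Proof.
move=> sT Ti; rewrite -det_tr; apply/det0P => -[v v0 vA].
have hA k : \sum_l pin i (1%:M - T) k l * v 0 l = 0.
  move/rowP: vA => /(_ k); rewrite !mxE => vAk; rewrite -[RHS]vAk.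
  by apply: eq_bigr => l _; rewrite [_^T _ _]mxE mulrC.
have vi : v 0 i = 0.
  have := hA i; rewrite (bigD1 i) //= mxE !eqxx mul1r big1 ?addr0 // => l li.
  by rewrite mxE eqxx eq_sym (negPf li) mul0r.
have hv k : k != i -> v 0 k = \sum_l T k l * v 0 l.
  move=> ki; apply/eqP; rewrite -subr_eq0 -(sum_row_sub1 T k (v 0)).
  apply/eqP; rewrite -[RHS](hA k); apply: eq_bigr => l _.
  by rewrite [in RHS]mxE (negPf ki).
have le0 := harmonic_le0 sT Ti vi hv.
have ge0 k : - v 0 k <= 0.
  apply: (harmonic_le0 (x := fun k => - v 0 k) sT Ti) => [|j ji].
    by rewrite vi oppr0.
  by rewrite hv // -sumrN; apply: eq_bigr => l _; rewrite mulrN.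
case/negP: v0; apply/eqP/rowP => k; rewrite mxE; apply/eqP.
by rewrite eq_le le0 -oppr_le0 ge0.
Qed.

Lemma sum_minors_gt0 T : stochastic T -> single_essential_class T ->
  0 < \sum_i \det (pin i (1%:M - T)).
Proof.
move=> sT /single_essential_class_reachable[i Ti].
have ge0 k : 0 <= \det (pin k (1%:M - T)).
  exact/dominant_det_ge0/dominant_pin/stochastic_dominant.
rewrite (bigD1 i) //= ltr_wpDr ?sumr_ge0 //.
by rewrite lt_neqAle eq_sym minor_neq0 ?ge0.
Qed.

End Chains.

(** * The inequality on pairs of indices *)

Section PairSum.
Variables (R : realFieldType) (n : nat).
Implicit Types (a p : 'I_n -> R).

(** With [P] the sum of the [p_j], [Q] that of the [a_j^2] and [X] that of the
    [a_j p_j], the sum over all pairs is [2 S^2 P + 2 S X - 2 Q P], and the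
    diagonal terms contribute [2 S X]. *)
Lemma sum_pair_weights a p :
  let S := \sum_j a j in
  \sum_i \sum_(j | j != i) (S * (a j * p i + a i * p j)
            + (a i - a j) * (a j * p i - a i * p j))
  = 2 * (S ^+ 2 - \sum_j a j ^+ 2) * \sum_j p j.
Proof.
move=> S.
pose g i j := S * (a j * p i + a i * p j)
            + (a i - a j) * (a j * p i - a i * p j).
have gE i : \sum_(j | j != i) g i j = \sum_j g i j - 2 * S * (a i * p i).
  by rewrite [in RHS](bigD1 i) //= /g; ring.
rewrite -/(\sum_i \sum_(j | j != i) g i j).
under eq_bigr do rewrite gE.
rewrite sumrB -mulr_sumr.
pose Q := \sum_j a j ^+ 2; pose P := \sum_j p j; pose X := \sum_j a j * p j.
have inner i : \sum_j g i j =
    S * S * p i + S * P * a i + (S * (a i * p i) - P * a i ^+ 2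
    - Q * p i + a i * X).
  rewrite /g big_split /= -!mulr_sumr big_split /= -!mulr_suml -mulr_sumr.
  rewrite -/S -/P.
  have -> : \sum_j (a i - a j) * (a j * p i - a i * p j) =
      \sum_j (a j * (a i * p i) - a i ^+ 2 * p j - a j ^+ 2 * p i
       + a i * (a j * p j)) by apply: eq_bigr => j _; ring.
  rewrite big_split /= !sumrB -!mulr_suml -!mulr_sumr -/S -/P -/Q -/X; ring.
under eq_bigr do rewrite inner.
rewrite !(big_split, sumrN) /= -!mulr_suml -!mulr_sumr -/S -/P -/Q -/X.
ring.
Qed.

(** Since [t] is at least the maximum of the two products [u] and [v], [2 S t]
    is at least [S (u + v) + S |u - v|], and [|a_i - a_j| <= a_i + a_j <= S]. *)
Lemma pair_weight_le a p (t : R) i j : (forall k, 0 <= a k) -> i != j ->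
  a j * p i <= t -> a i * p j <= t ->
  (\sum_k a k) * (a j * p i + a i * p j)
            + (a i - a j) * (a j * p i - a i * p j) <= 2 * (\sum_k a k) * t.
Proof.
move=> a0 ij; set S := \sum_k a k; set u := a j * p i; set v := a i * p j.
move=> ut vt.
have aS k l : k != l -> a k + a l <= S.
  move=> kl; rewrite /S (bigD1 k) //= (bigD1 l) 1?eq_sym //= addrA lerDl.
  exact: sumr_ge0.
have := aS _ _ ij; have := a0 i; have := a0 j; nra.
Qed.

End PairSum.

(** * The chain along a directed cycle *)

Section Cycle.
Variables (R : realType) (n : nat) (d : 'I_n -> R) (s : 'I_n -> 'I_n).
Hypothesis d_range : forall j, 0 <= d j < 1.
Hypothesis s_neq : forall i, s i != i.
Hypothesis s_conn : forall i j, connect (frel s) i j.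

Definition orbit_chain : 'M[R]_n :=
  \matrix_(i, j) (d i *+ (j == i) + (1 - d i) *+ (j == s i)).

Lemma orbit_chain_diag i : orbit_chain i i = d i.
Proof. by rewrite mxE eqxx eq_sym (negPf (s_neq i)) addr0. Qed.

Lemma sum_orbit_chain i (y : 'I_n -> R) :
  \sum_j orbit_chain i j * y j = d i * y i + (1 - d i) * y (s i).
Proof.
have pick c k : \sum_j (c *+ (j == k)) * y j = c * y k.
  rewrite (bigD1 k) //= eqxx big1 ?addr0 // => j jk.
  by rewrite (negPf jk) mul0r.
under eq_bigr do rewrite mxE mulrDl.
by rewrite big_split /= !pick.
Qed.

Lemma orbit_chain_stochastic : stochastic orbit_chain.
Proof.
split=> [i j|i].
  have /andP[d0 d1] := d_range i.
  by rewrite mxE addr_ge0 // mulrn_wge0 // subr_ge0 ltW.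
have := sum_orbit_chain i (fun=> 1); under eq_bigr do rewrite mulr1.
by move=> ->; rewrite !mulr1 addrC subrK.
Qed.

Lemma orbit_chain_single_class : (0 < n)%N -> single_essential_class orbit_chain.
Proof.
move=> n0; have conn i j : connect (arc orbit_chain) i j.
  move: (s_conn i j); apply: connect_sub => x y /eqP <-; apply: connect1.
  have /andP[_ d1] := d_range x.
  by rewrite /arc mxE eqxx (negPf (s_neq x)) add0r subr_gt0.
have ess : [set j | essential orbit_chain j] = [set: 'I_n].
  by apply/setP => j; rewrite !inE; apply/forallP => k; rewrite !conn.
apply/eqP/cards1P; exists [set: 'I_n]; apply/setP => A.
rewrite /essential_classes ess inE; apply/imsetP/eqP => [[x _ ->]|->].
  by apply/setP => y; rewrite !inE !conn.
by exists (Ordinal n0); rewrite ?inE //; apply/setP => y; rewrite !inE !conn.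
Qed.

(** The cofactors [y] of row [j] of the pinned matrix satisfy [y k = y (s k)] at
    each [k] other than [i] and [j], and [y i = 0].  Following the cycle from
    [s j], which reaches [i] before it returns to [j], gives [y (s j) = 0], so
    that only the diagonal term remains in the expansion along row [j]. *)
Lemma orbit_chain_minor i j : i != j ->
  \det (pin i (1%:M - orbit_chain)) =
  (1 - d j) * \det (pin j (pin i (1%:M - orbit_chain))).
Proof.
move=> ij; set L := 1%:M - orbit_chain.
pose y k := cofactor (pin i L) j k.
have rowL k : \sum_l L k l * y l = (1 - d k) * (y k - y (s k)).
  rewrite sum_row_sub1 sum_orbit_chain; ring.
have rowE k : k != i -> \sum_l pin i L k l * y l = (1 - d k) * (y k - y (s k)).
  move=> ki; rewrite -rowL; apply: eq_bigr => l _.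
  by rewrite [pin _ _ _ _]mxE (negPf ki).
have yi : y i = 0.
  have := mul_cofactor i j (pin i L); rewrite (negPf ij) mulr0n.
  rewrite (bigD1 i) //= mxE !eqxx mul1r big1 ?addr0 // => l li.
  by rewrite mxE eqxx eq_sym (negPf li) mul0r.
have ys k : k != i -> k != j -> y k = y (s k).
  move=> ki kj; have := mul_cofactor k j (pin i L).
  rewrite (negPf kj) mulr0n rowE // => /eqP; rewrite mulf_eq0 !subr_eq0.
  have /andP[_ d1] := d_range k.
  by rewrite gt_eqF //= => /eqP.
have ysj : y (s j) = 0.
  (* The indices where [y] does not vanish would be stable under [s], hence all
     of them, and [i] would be among them. *)
  apply/eqP; apply: contraT => ysj.
  have cl k : y k != 0 -> y (s k) != 0.
    have [-> //|kj] := eqVneq k j.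
    have [->|ki] := eqVneq k i; first by rewrite yi eqxx.
    by rewrite ys.
  have /connectP[p pth lastp] := s_conn (s j) i.
  suff : y i != 0 by rewrite yi eqxx.
  rewrite lastp; elim: p (s j) pth ysj {lastp} => //= x p IH z.
  by move=> /andP[/eqP <- /IH h] /cl.
have := mul_cofactor j j (pin i L); rewrite eqxx mulr1n => <-.
by rewrite rowE 1?eq_sym // ysj subr0 /y cofactor_diag.
Qed.

End Cycle.

(** * Kemeny's constant for a given diagonal *)

Section Bound.
Variables (R : realType) (n : nat) (d : 'I_n -> R) (T : 'M[R]_n).
Hypothesis n_gt0 : (0 < n)%N.
Hypothesis d_range : forall j, 0 <= d j < 1.
Hypothesis T_sto : stochastic T.
Hypothesis T_sec : single_essential_class T.

Let a j := (1 - d j)^-1.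
Let S := \sum_j a j.
Let p i := \det (pin i (1%:M - T)).
Let t i j := \det (pin j (pin i (1%:M - T))).

Lemma inv_subr_gt0 j : 0 < a j.
Proof. by have /andP[_ d1] := d_range j; rewrite invr_gt0 subr_gt0. Qed.

Lemma sum_inv_gt0 : 0 < S.
Proof.
rewrite /S (bigD1 (Ordinal n_gt0)) //= ltr_wpDr ?inv_subr_gt0 //.
by apply: sumr_ge0 => j _; rewrite ltW ?inv_subr_gt0.
Qed.

(** The excess over the bound is a sum over pairs, one term for each pair: the
    terms are nonnegative when [T] has diagonal [d] ([kemeny_ge]) and they
    vanish for the chain along a cycle ([kemeny_eq]). *)
Lemma kemeny_sub_bound : kemeny T - (S ^+ 2 - \sum_j a j ^+ 2) / (2 * S) =
  (\sum_i \sum_(j | j != i)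
     (2 * S * t i j - (S * (a j * p i + a i * p j)
                       + (a i - a j) * (a j * p i - a i * p j))))
  / (4 * S * \sum_i p i).
Proof.
have P0 := sum_minors_gt0 T_sto T_sec.
under [in RHS]eq_bigr do rewrite sumrB -mulr_sumr.
rewrite sumrB -mulr_sumr sum_pair_weights -/S.
rewrite kemeny_minors ?gt_eqF //; last exact: (proj2 T_sto).
rewrite -/(\sum_i p i) -/(\sum_i \sum_(j | j != i) t i j).
have S0 := sum_inv_gt0.
by field; rewrite !gt_eqF.
Qed.

Lemma kemeny_ge : (forall i, T i i = d i) ->
  (S ^+ 2 - \sum_j a j ^+ 2) / (2 * S) <= kemeny T.
Proof.
move=> Td; rewrite -subr_ge0 kemeny_sub_bound.
have P0 : 0 < \sum_i p i := sum_minors_gt0 T_sto T_sec.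
have S0 := sum_inv_gt0.
have le_t i j : i != j -> a j * p i <= t i j.
  move=> ij; have /andP[_ d1] := d_range j.
  rewrite mulrC ler_pdivrMr ?subr_gt0 // mulrC.
  have := dominant_det_le j (dominant_pin i (stochastic_dominant T_sto)).
  by rewrite [X in X * _]mxE eq_sym (negPf ij) !mxE eqxx Td.
apply: divr_ge0; last by rewrite !mulr_ge0 // ltW.
apply: sumr_ge0 => i _.
apply: sumr_ge0 => j ji; rewrite subr_ge0.
apply: pair_weight_le; rewrite 1?eq_sym //; first by move=> k; rewrite ltW ?inv_subr_gt0.
  by rewrite le_t 1?eq_sym.
by rewrite /t pinC le_t.
Qed.

Lemma kemeny_eq : (forall i j, i != j -> p i = (1 - d j) * t i j) ->
  kemeny T = (S ^+ 2 - \sum_j a j ^+ 2) / (2 * S).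
Proof.
move=> h; apply/eqP; rewrite -subr_eq0 kemeny_sub_bound; apply/eqP.
have ap i j : i != j -> a j * p i = t i j.
  move=> ij; have /andP[_ d1] := d_range j.
  by rewrite (h i j ij) /a mulKf // gt_eqF // subr_gt0.
rewrite big1 ?mul0r // => i _; rewrite big1 // => j ji.
have tC : t i j = t j i by rewrite /t pinC.
rewrite (ap i j) 1?eq_sym // (ap j i) // -tC; ring.
Qed.

End Bound.

(** * The infimum *)

Lemma connect_succ n (i j : 'I_n.+2) : connect (frel (fun k => k + 1)) i j.
Proof.
have step m : connect (frel (fun k : 'I_n.+2 => k + 1)) i (i + m%:R).
  elim: m => [|m IH]; first by rewrite addr0.
  apply: connect_trans IH (connect1 _).
  by rewrite /= -addrA natr1.
by have := step (val (j - i)); rewrite natr_Zp addrC subrK.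
Qed.

Theorem theorem3p6 (R : realType) (n : nat) (n_gt0 : (0 < n)%N)
    (d : 'I_n -> R) (P : 'M[option R]_n)
    (d_range : forall j, 0 <= d j < 1)
    (P_ps : partial_stochastic P)
    (P_diag : forall j, P j j = Some (d j))
    (P_offdiag : forall i j, i != j -> P i j = None) :
  m P = (1 / (2 * \sum_(j < n) 1 / (1 - d j))
         * ((\sum_(j < n) 1 / (1 - d j)) ^+ 2
            - \sum_(j < n) 1 / (1 - d j) ^+ 2))%:E.
Proof.
have -> : \sum_(j < n) 1 / (1 - d j) = \sum_j (1 - d j)^-1.
  by apply: eq_bigr => j _; rewrite mul1r.
have -> : \sum_(j < n) 1 / (1 - d j) ^+ 2 = \sum_j (1 - d j)^-1 ^+ 2.
  by apply: eq_bigr => j _; rewrite mul1r exprVn.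
rewrite mul1r mulrC.
apply/eqP; rewrite eq_le; apply/andP; split; last first.
  apply: le_ereal_inf_tmp => _ [T [[Tc Ts] Te] <-]; rewrite lee_fin.
  by apply: kemeny_ge => // i; apply: Tc.
(* When [n = 1] the only row is fully specified, so its entry [d ord0 < 1] would
   have to be 1. *)
have n_gt1 : (1 < n)%N.
  case: n n_gt0 d P d_range P_ps P_diag P_offdiag => [//|[|//]].
  move=> _ d P d_range P_ps P_diag _; exfalso.
  have full : fully_specified P ord0.
    by apply/forallP => j; rewrite !ord1 P_diag.
  have := fully_specified_sum1 P_ps full.
  rewrite /specified_sum (bigD1 ord0) ?P_diag //= big1 ?addr0; last first.
    by move=> j /andP[_]; rewrite ord1.
  by have /andP[_ d1] := d_range ord0 => dE; rewrite dE ltxx in d1.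
case: n n_gt0 n_gt1 d P d_range P_ps P_diag P_offdiag => [//|[//|n]].
move=> n_gt0 _ d P d_range P_ps P_diag P_offdiag.
pose s (k : 'I_n.+2) := k + 1.
have s_neq k : s k != k by rewrite /s -subr_eq0 addrC addKr oner_eq0.
have s_conn : forall i j, connect (frel s) i j := @connect_succ n.
pose T := orbit_chain d s.
have Ts : stochastic T := orbit_chain_stochastic s d_range.
have Te : single_essential_class T.
  exact: orbit_chain_single_class.
apply: ereal_inf_lbound; exists T.
  split=> //; split=> // i j x; have [<-|ij] := eqVneq i j.
    by rewrite P_diag orbit_chain_diag // => -[].
  by rewrite P_offdiag.
congr EFin; apply: kemeny_eq => // i j ij.
exact: orbit_chain_minor.
Qed.
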